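(* Let $s\ge 1$ and let $\alpha\in\mathbb{R}^s$ be totally irrational. Then every special region $A$ for $\alpha$, regarded as a subset of $\mathbb{T}^s$ via the canonical projection $\mathbb{R}^s\to\mathbb{T}^s$, is a bounded remainder set for the rotation $T:\mathbb{T}^s\to\mathbb{T}^s$, $T(x)=x+\alpha$; that is, $$\sup_{x\in\mathbb{R}^s}\ \sup_{N\in\mathbb{N}}\left|\sum_{n=0}^{N-1}\chi_A(T^n(x))-N|A|\right|<\infty.$$
   Context: Write $\mathbb{T}^s=\mathbb{R}^s/\mathbb{Z}^s$. A vector $\alpha\in\mathbb{R}^s$ is totally irrational if $\{n\alpha\}_{n\in\mathbb{N}}$ is dense in $\mathbb{T}^s$. For a measurable $A\subseteq\mathbb{T}^s$, $\chi_A$ is its indicator function and $|A|$ its Lebesgue measure. Let $\alpha':=(\alpha,1)\in\mathbb{R}^{s+1}$ and let $\Lambda$ be the lattice in $\mathbb{R}^{s+1}$ generated by $\alpha'$ and the first $s$ standard basis vectors $e_1,\dots,e_s$; thus $\Lambda=\{(n\alpha_1+a_1,\dots,n\alpha_s+a_s,n): n,a_1,\dots,a_s\in\mathbb{Z}\}$. Let $\varphi:\mathbb{R}^{s+1}\to\mathbb{R}^s$ be the projection onto the first $s$ coordinates and let $\varphi_{s+1}:\mathbb{R}^{s+1}\to\mathbb{R}$ be the projection onto the last coordinate. For linearly independent vectors $u_1,\dots,u_m\in\mathbb{R}^{s+1}$, $P(u_1,\dots,u_m)$ denotes the parallelotope they generate in the linear subspace they span, with the boundary chosen so that $P(u_1,\dots,u_m)$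 is a fundamental domain, in that subspace, for the lattice generated by $u_1,\dots,u_m$ (e.g. $P(u_1,\dots,u_m)=\{\sum_{i=1}^m t_iu_i: 0\le t_i<1\}$). Special region: a set $A\subseteq\mathbb{R}^s$ is a special region for $\alpha$ if there exist vectors $v_1,\dots,v_{s+1}\in\Lambda$ such that: (S1) $A=\varphi(P(v_1,\dots,v_s))$; (S2) $\varphi(v_{s+1})\in A$; (S3) $v_1,\dots,v_{s+1}$ form a $\mathbb{Z}$-basis of $\Lambda$; (S4) for every subset $I\subseteq\{1,\dots,s\}$, $\varphi_{s+1}(v_{s+1})-\sum_{i\in I}\varphi_{s+1}(v_i)>0$. *)

(* Defs.v *)
From HB Require Import structures.
From mathcomp Require Import all_boot all_order all_algebra.
From mathcomp Require Import all_classical all_reals all_analysis.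

Set Implicit Arguments.
Unset Strict Implicit.
Unset Printing Implicit Defensive.

Import Order.TTheory GRing.Theory Num.Theory.
Import numFieldNormedType.Exports.

Local Open Scope classical_set_scope.
Local Open Scope ring_scope.
Local Open Scope quotient_scope.

Section Torus.
Context {R : realType} {s : nat}.

Definition intvec (v : 'rV[R]_s) : bool := v \is a mxOver Num.int.

Lemma intvec_closed : zmod_closed intvec.
Proof.
split; first exact: (mxOver0 (rpred0 _)).
move=> x y /mxOverP xZ /mxOverP yZ; apply/mxOverP => i j.
by rewrite !mxE rpredB.
Qed.

HB.instance Definition _ := GRing.isZmodClosed.Build _ intvec intvec_closed.

End Torus.

Section TorusType.
Variables (R : realType) (s : nat).

Local Notation group_quotient :=
  (Quotient.quot ((@intvec R s : {pred 'rV[R]_s}) : zmodClosed 'rV[R]_s)).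

(* The quotient group R^s / Z^s with the quotient topology. *)
Definition torus : Type := quotient_topology group_quotient.

HB.instance Definition _ := Topological.on torus.
HB.instance Definition _ := Quotient.on torus.
HB.instance Definition _ := GRing.Zmodule.copy torus group_quotient.

Definition torus_proj (x : 'rV[R]_s) : torus := \pi_torus x.

Lemma torus_projD x y : torus_proj (x + y) = torus_proj x + torus_proj y.
Proof. exact: (raddfD \pi_group_quotient). Qed.

Lemma torus_projP x y :
  torus_proj x = torus_proj y <-> x - y \is a mxOver Num.int.
Proof.
have -> : (x - y \is a mxOver Num.int) =
    (x - y \in ((@intvec R s : {pred 'rV[R]_s}) : zmodClosed 'rV[R]_s)) by [].
rewrite Quotient.idealrBE; split => [h|/eqP h]; last exact: h.
exact/eqP.
Qed.

End TorusType.

Section Lebesgue.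
Context {R : realType}.

Local Notation mR := (measurableTypeR R).
Local Notation cons_pair n :=
  (fun p : mR * n.-tuple mR => [tuple of p.1 :: p.2] : n.+1.-tuple mR).

Lemma measurable_cons_pair n : measurable_fun setT (cons_pair n).
Proof. exact: measurable_cons measurable_fst measurable_snd. Qed.

Section Step.
Variables (n : nat) (mu : {sigma_finite_measure set (n.-tuple mR) -> \bar R}).

Definition lebesgue_step : set (n.+1.-tuple mR) -> \bar R :=
  pushforward (lebesgue_measure \x mu)%E (cons_pair n).

Let mcons := @measurable_cons_pair n.

Let step0 : lebesgue_step set0 = 0%E.
Proof. exact: measure0. Qed.

Let step_ge0 A : (0 <= lebesgue_step A)%E.
Proof. exact: measure_ge0. Qed.

Let step_sigma_additive : semi_sigma_additive lebesgue_step.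
Proof. exact: measure_semi_sigma_additive. Qed.

HB.instance Definition _ := isMeasure.Build _ _ _ lebesgue_step
  step0 step_ge0 step_sigma_additive.

Let step_sigma_finite : sigma_finite setT lebesgue_step.
Proof.
have /sigma_finiteP[F [TF ndF Foo]] := sigma_finiteT (@lebesgue_measure R).
have /sigma_finiteP[G [TG ndG Goo]] := sigma_finiteT mu.
pose u (t : n.+1.-tuple mR) : mR * n.-tuple mR := (thead t, [tuple of behead t]).
have mu_ : measurable_fun setT u.
  apply: measurable_fun_pair; last exact: measurable_behead.
  exact: measurable_tnth.
have uK p : u (cons_pair n p) = p.
  by case: p => a b; rewrite /u /=; congr pair; apply: val_inj.
exists (fun k => u @^-1` (F k `*` G k)).
  rewrite -preimage_bigcup -[LHS](preimage_setT u); congr (_ @^-1` _).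
  rewrite -setXTT TF TG; apply/seteqP; split=> -[x y].
    move=> [/= [i _ Fix] [j _ Gjy]]; exists (maxn i j) => //; split.
      by move: x Fix; exact/subsetPset/ndF/leq_maxl.
    by move: y Gjy; exact/subsetPset/ndG/leq_maxr.
  by move=> [i _ [/= ? ?]]; split; exists i.
move=> k; have [mF Fk] := Foo k; have [mG Gk] := Goo k; split.
  by rewrite -[X in measurable X]setTI; apply: mu_ => //; exact: measurableX.
rewrite /lebesgue_step /pushforward -comp_preimage.
rewrite (_ : u \o _ = id); last by apply/funext => p /=; exact: uK.
by rewrite preimage_id product_measure1E// lte_mul_pinfty// ge0_fin_numE.
Qed.

HB.instance Definition _ := Measure_isSigmaFinite.Build _ _ _ lebesgue_step
  step_sigma_finite.

End Step.

(* Lebesgue measure on the Borel sets of R^n: the n-fold product of the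
   one-dimensional Lebesgue measure. *)
Fixpoint lebesgue_prod n : {sigma_finite_measure set (n.-tuple mR) -> \bar R} :=
  match n with
  | 0 => \d_[tuple]
  | n'.+1 => lebesgue_step (lebesgue_prod n')
  end.

Lemma measurable_box n (B : 'I_n -> set mR) :
  (forall i, measurable (B i)) ->
  measurable [set t : n.-tuple mR | forall i, B i (tnth t i)].
Proof.
move=> mB.
rewrite (_ : mkset _ = \bigcap_(i in [set: 'I_n]) ((fun t => tnth t i) @^-1` B i)).
  apply: fin_bigcap_measurable; first exact: finite_finset.
  move=> i _; rewrite -[X in measurable X]setTI.
  exact: measurable_tnth.
by apply/seteqP; split=> t /= h i; [move=> _|]; exact: h.
Qed.

Lemma lebesgue_prod_box n (B : 'I_n -> set mR) :
  (forall i, measurable (B i)) ->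
  lebesgue_prod n [set t | forall i, B i (tnth t i)] =
  (\prod_(i < n) lebesgue_measure (B i))%E.
Proof.
elim: n B => [|n IH] B mB.
  by rewrite big_ord0 /= diracE mem_set// => -[].
rewrite big_ord_recl /= /lebesgue_step /pushforward.
rewrite (_ : _ @^-1` _ = B ord0 `*`
    [set t : n.-tuple mR | forall i, B (lift ord0 i) (tnth t i)]).
  rewrite product_measure1E//; last first.
    by apply: (@measurable_box _ (fun i => B (lift ord0 i))) => i; exact: mB.
  by rewrite (IH (fun i => B (lift ord0 i))).
apply/seteqP; split=> -[x t] /=.
  move=> h; split; first exact: (h ord0).
  by move=> i; have := h (lift ord0 i); rewrite tnthS.
by move=> [h0 h] i; case: (unliftP ord0 i) => [j|] ->; rewrite ?tnthS.
Qed.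

End Lebesgue.

Section Rotation.
Context {R : realType} {s : nat}.
Implicit Types (alpha : 'rV[R]_s) (A : set (torus R s)).

(* The Lebesgue (Haar) measure of the torus is read off on the fundamental
   domain [0, 1[^s. The outer measure induced by [lebesgue_prod] is the usual
   extension of the product measure to all Lebesgue measurable sets. *)
Definition torus_measure A : \bar R :=
  ((lebesgue_prod s)^*)%mu
    [set t : s.-tuple (measurableTypeR R) |
      (forall i, 0 <= tnth t i < 1) /\ A (torus_proj (\row_i tnth t i))].

Definition totally_irrational alpha : Prop :=
  dense (range (fun n : nat => torus_proj (alpha *+ n))).

Definition rotation alpha (x : torus R s) : torus R s := x + torus_proj alpha.

Definition bounded_remainder_set alpha A : Prop :=
  (ereal_sup [set ereal_sup [set
      `| \sum_(n < N) \1_A (iter n (rotation alpha) (torus_proj x))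
         - N%:R * fine (torus_measure A) |%:E | N in [set: nat]]
    | x in [set: 'rV[R]_s]] < +oo)%E.

End Rotation.

Section Parallelotope.
Context {R : realType} {d m : nat}.
Implicit Types (u : 'I_m -> 'rV[R]_d) (P : set 'rV[R]_d).

(* [parallelotope u P] : P is the parallelotope generated by the linearly
   independent vectors u, for some choice of the boundary making it a
   fundamental domain, in the span of u, for the lattice generated by u. *)
Definition parallelotope u P : Prop :=
  [/\ row_free (\matrix_(i < m) u i),
      P `<=` [set \sum_i t i *: u i | t in [set t | forall i, 0 <= t i <= 1]]
    & forall t : 'I_m -> R, exists! p, P p /\
        exists c : 'I_m -> int, \sum_i t i *: u i = p + \sum_i u i *~ c i].

Lemma parallelotope_half_open u : row_free (\matrix_(i < m) u i) ->
  parallelotope u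
    [set \sum_i t i *: u i | t in [set t | forall i, 0 <= t i < 1]].
Proof.
move=> fu; split=> //.
  move=> _ [t t01 <-]; exists t => // i.
  by have /andP[-> /ltW] := t01 i.
have sumE (t : 'I_m -> R) :
    \sum_i t i *: u i = (\row_i t i) *m \matrix_(i < m) u i.
  rewrite mulmx_sum_row; apply: eq_bigr => i _.
  by rewrite mxE rowK.
have u_inj (t t' : 'I_m -> R) :
    \sum_i t i *: u i = \sum_i t' i *: u i -> t =1 t'.
  by rewrite !sumE => /(row_free_inj fu)/rowP tt' i; have := tt' i; rewrite !mxE.
have addE (t : 'I_m -> R) (c : 'I_m -> int) :
    \sum_i t i *: u i + \sum_i u i *~ c i = \sum_i (t i + (c i)%:~R) *: u i.
  by rewrite -big_split; apply: eq_bigr => i _; rewrite scalerDl scaler_int.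
move=> t; exists (\sum_i (t i - (Num.floor (t i))%:~R) *: u i); split.
  split.
    exists (fun i => t i - (Num.floor (t i))%:~R) => //= i.
    by rewrite subr_ge0 floor_le ltrBlDl -intrD1 floorD1_gt.
  exists (fun i => Num.floor (t i)).
  by rewrite addE; apply: eq_bigr => i _; rewrite subrK.
move=> _ [[t' t'01 <-] [c]]; rewrite addE => /u_inj tE.
apply: eq_bigr => i _; congr (_ *: _); have /andP[t'0 t'1] := t'01 i.
rewrite tE (_ : Num.floor _ = c i) ?addrK//.
by apply/floor_def; rewrite lerDr t'0 intrD [t' i + _]addrC ltrD2l.
Qed.

End Parallelotope.

Section SpecialRegion.
Context {R : realType} {s : nat}.
Implicit Types (alpha : 'rV[R]_s) (A : set 'rV[R]_s).

Definition lattice alpha : set 'rV[R]_(s + 1) :=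
  [set row_mx alpha 1 *~ n + \sum_(i < s) delta_mx 0 (lshift 1 i) *~ a i
    | n in [set: int] & a in [set: 'I_s -> int]].

Definition phi (w : 'rV[R]_(s + 1)) : 'rV[R]_s := lsubmx w.

Definition phi_last (w : 'rV[R]_(s + 1)) : R := w 0 (rshift s ord0).

Definition Zbasis d k (L : set 'rV[R]_d) (v : 'I_k -> 'rV[R]_d) : Prop :=
  (forall i, L (v i)) /\
  (forall w, L w -> exists! c : {ffun 'I_k -> int}, w = \sum_i v i *~ c i).

Definition special_region alpha A : Prop :=
  exists v : 'I_(s + 1) -> 'rV[R]_(s + 1),
    let v_ (i : 'I_s) := v (lshift 1 i) in
    let v_last := v (rshift s ord0) in
    [/\ exists2 P, parallelotope v_ P & A = phi @` P,
        A (phi v_last),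
        Zbasis (lattice alpha) v
      & forall I : {set 'I_s}, 0 < phi_last v_last - \sum_(i in I) phi_last (v_ i)].

End SpecialRegion.

(* Main.v *)
Require Import Defs.
From HB Require Import structures.
From mathcomp Require Import all_boot all_order all_algebra.
From mathcomp Require Import all_classical all_reals all_analysis.
From mathcomp Require Import measurable_realfun ring lra zify.

(* Fix x. In each coset k v_(s+1) + <v_1, ..., v_s> of the lattice there is
   essentially one point w_k with x + phi(w_k) in A, because A is a fundamental
   domain of phi(<v_1, ..., v_s>). Passing from w_k to w_(k+1) adds v_(s+1) and
   subtracts some subset sum of v_1, ..., v_s, so by (S4) the heights of the w_k
   increase strictly, and they stay at bounded distance from an arithmetic
   progression of step D. As these heights are the times at which the orbit of
   x visits A, there are N/D + O(1) visits before time N, uniformly in x;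
   the choices made on the boundary of A affect boundedly many times, as total
   irrationality forbids an orbit to return to a face.
   No determinant is needed to see that |A| = 1/D: the estimate also holds for
   the open and the closed parallelotope, and integrating it over the torus,
   with invariance of the measure under rotation, shows that both have
   measure 1/D. *)

Set Implicit Arguments.
Unset Strict Implicit.
Unset Printing Implicit Defensive.

Import Order.TTheory GRing.Theory Num.Theory.
Import numFieldNormedType.Exports.

Local Open Scope classical_set_scope.
Local Open Scope ring_scope.

(** * Rotation invariance of the measure of the torus *)

Section Translation.
Context {R : realType}.
Local Notation mR := (measurableTypeR R).

Lemma measurable_addr (b : R) : measurable_fun setT (fun t : mR => t + b : mR).
Proof. by apply: measurable_funD. Qed.

Lemma lebesgue_measure_translate (b : R) (E : set mR) : measurable E ->
  lebesgue_measure ((fun t : mR => t + b : mR) @^-1` E) = lebesgue_measure E.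
Proof.
move=> mE; apply/esym.
rewrite -/(pushforward lebesgue_measure (fun t : mR => t + b : mR) E).
have H := measurable_addr b.
apply: lebesgue_measure_unique mE => _ [[x y] _ <-] /=.
rewrite /pushforward.
rewrite (_ : _ @^-1` _ = `](x - b), (y - b)]%classic); last first.
  by apply/seteqP; split=> t /=; rewrite !in_itv /= ltrBlDr lerBrDr.
by rewrite !lebesgue_measure_itv /= !lte_fin ltrD2r -!EFinD; case: ifP => // _;
  congr (_%:E); ring.
Qed.

(* On [0, 1[ this is the fractional part of [t + b]; outside, its values are
   irrelevant. *)
Definition wrap (b t : R) : R :=
  t + (b - (Num.floor b)%:~R) -
  (if t < 1 - (b - (Num.floor b)%:~R) then 0 else 1).

Lemma measurable_wrap b : measurable_fun setT (wrap b : mR -> mR).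
Proof.
apply: measurable_funB; first exact: measurable_addr.
apply: measurable_fun_ifT => //.
exact: measurable_fun_ltr.
Qed.

Lemma wrap_int b t : t + b - wrap b t \is a Num.int.
Proof.
rewrite /wrap; case: ifP => _.
  by rewrite (_ : _ - _ = (Num.floor b)%:~R) ?intr_int//; ring.
by rewrite (_ : _ - _ = (Num.floor b + 1)%:~R) ?intr_int// intrD1; ring.
Qed.

(** With [c] the fractional part of [b], the map exchanges two intervals: it moves [0, 1 - c[ onto
    [c, 1[ and [1 - c, 1[ onto [0, c[, each by a translation. *)
Lemma lebesgue_measure_wrap b (E : set mR) : measurable E ->
  lebesgue_measure (`[0, 1[%classic `&` wrap b @^-1` E) =
  lebesgue_measure (`[0, 1[%classic `&` E).
Proof.
move=> mE.
have /andP[f0 f1] := floor_itv b; move: f1; rewrite intrD1 => f1.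
pose c := b - (Num.floor b)%:~R.
have c0 : 0 <= c by rewrite /c; lra.
have c1 : c < 1 by rewrite /c; lra.
have -> : `[0, 1[%classic `&` wrap b @^-1` E =
    ((fun t : mR => t + c : mR) @^-1` (`[c, 1[%classic `&` E)) `|`
    ((fun t : mR => t + (c - 1) : mR) @^-1` (`[0, c[%classic `&` E)).
  apply/seteqP; split => t /=; rewrite !in_itv /= /wrap -/c.
    move=> [/andP[t0 t1]]; case: ltP => h Et; [left|right].
      by rewrite subr0 in Et; split => //; apply/andP; split; lra.
    by rewrite addrA; split => //; apply/andP; split; lra.
  case=> -[/andP[t0 t1] Et]; (split; first by apply/andP; split; lra).
    by rewrite ifT ?subr0//; lra.
  rewrite ifF; last by apply: negbTE; rewrite -leNgt; lra.
  by rewrite -addrA.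
have mt (d : R) (F : set mR) : measurable F ->
    measurable ((fun t : mR => t + d : mR) @^-1` F).
  by move=> mF; rewrite -[X in measurable X]setTI; exact: measurable_addr.
have m1 : measurable (`[c, 1[%classic `&` E : set mR) by exact: measurableI.
have m2 : measurable (`[0, c[%classic `&` E : set mR) by exact: measurableI.
rewrite measureU; [|exact: mt|exact: mt|]; last first.
  apply/seteqP; split => t //=; rewrite !in_itv /=.
  by move=> [[/andP[? ?] _] [/andP[? ?] _]]; lra.
rewrite [X in (X + _)%E]lebesgue_measure_translate//.
rewrite [X in (_ + X)%E]lebesgue_measure_translate//.
rewrite -measureU//; last first.
  apply/seteqP; split => t //=; rewrite !in_itv /=.
  by move=> [[/andP[? ?] _] [/andP[? ?] _]]; lra.
congr lebesgue_measure; rewrite -setIUl; congr (_ `&` _).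
apply/seteqP; split => t /=; rewrite !in_itv /=.
  by case=> /andP[? ?]; lra.
by move=> /andP[? ?]; case: (ltP t c) => ?; [right|left]; apply/andP; split.
Qed.

End Translation.

Section CubeRotation.
Context {R : realType} {s : nat}.
Local Notation mR := (measurableTypeR R).
Local Notation tup := (s.-tuple mR).

(** Boxes are stable under intersection and generate the sigma-algebra, so finite measures need only
    be compared on them. *)
Definition boxes : set (set tup) :=
  [set [set t : tup | forall i, B i (tnth t i)]
    | B in [set B : 'I_s -> set mR | forall i, measurable (B i)]].

Lemma measurable_boxes : measurable = <<s boxes >> :> set (set tup).
Proof.
apply/seteqP; split; last first.
  apply: smallest_sub; first exact: sigma_algebra_measurable.
  by move=> _ [B mB <-]; exact: measurable_box.
apply: smallest_sub; first exact: smallest_sigma_algebra.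
rewrite -bigcup_seq => X [i _ [B mB <-]].
apply: sub_sigma_algebra.
exists (fun j => if j == i then B else setT).
  by move=> j /=; case: ifP.
apply/seteqP; split => t /=.
  by move=> /(_ i); rewrite eqxx.
by move=> [_ Bt] j; case: eqP => // ->.
Qed.

Definition cube : set tup := [set t | forall i, 0 <= tnth t i < 1].

Lemma cubeE : cube = [set t | forall i, (`[0, 1[%classic : set mR) (tnth t i)].
Proof. by apply/seteqP; split => t /= + i => /(_ i); rewrite in_itv. Qed.

Lemma measurable_cube : measurable cube.
Proof.
rewrite cubeE.
by apply: (@measurable_box R s (fun=> `[0, 1[%classic)) => i.
Qed.

Lemma lebesgue_prod_cube : lebesgue_prod s cube = 1%E.
Proof.
rewrite cubeE (@lebesgue_prod_box _ _ (fun=> `[0, 1[%classic))//.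
by rewrite big1// => i _; rewrite lebesgue_measure_itv /= lte_fin ltr01 sube0.
Qed.

Definition wrapt (b : 'rV[R]_s) (t : tup) : tup :=
  [tuple wrap (b 0 i) (tnth t i) | i < s].

Lemma measurable_wrapt b : measurable_fun setT (wrapt b).
Proof.
apply/measurable_fun_tnthP => i.
rewrite (_ : _ \o _ = wrap (b 0 i) \o (fun t => tnth t i)).
  exact: measurableT_comp (measurable_wrap _) (measurable_tnth _).
by apply/funext => t /=; rewrite tnth_mktuple.
Qed.

(** Both sides are finite measures in [E]. On a box they are products of one-dimensional measures,
    and [lebesgue_measure_wrap] applies to each side of the box. *)
Lemma lebesgue_prod_wrapt b (E : set tup) : measurable E ->
  lebesgue_prod s (cube `&` wrapt b @^-1` E) = lebesgue_prod s (cube `&` E).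
Proof.
move=> mE.
have mw := measurable_wrapt b.
pose m2 := mrestr (lebesgue_prod s) measurable_cube.
rewrite -[RHS](_ : m2 E = _); last by rewrite /m2 /mrestr setIC.
rewrite -[LHS](_ : pushforward m2 (wrapt b) E = _); last first.
  by rewrite /pushforward /m2 /mrestr setIC.
apply: (measure_unique boxes (fun=> setT)) => //.
- exact: measurable_boxes.
- move=> _ _ [B mB <-] [C mC <-]; exists (fun i => B i `&` C i).
    by move=> i; exact: measurableI.
  apply/seteqP; split => t /=; last by move=> [? ?] i; split.
  by move=> h; split => i; have [] := h i.
- move=> _; exists (fun=> setT) => //=.
  by apply/seteqP; split.
- exact: bigcup_const.
- move=> _ [B mB <-].
  rewrite -[LHS]/(lebesgue_prod s (wrapt b @^-1` _ `&` cube)).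
  rewrite -[RHS]/(lebesgue_prod s (_ `&` cube)) setIC [in RHS]setIC cubeE.
  rewrite [X in lebesgue_prod s X](_ : _ = [set t : tup | forall i,
    (`[0, 1[%classic `&` (wrap (b 0 i) @^-1` B i)) (tnth t i)]); last first.
    apply/seteqP; split => t /=.
      move=> [h1 h2] i; split; first exact: h1.
      by have := h2 i; rewrite tnth_mktuple.
    by move=> h; split => i; rewrite ?tnth_mktuple; have [] := h i.
  rewrite [X in _ = lebesgue_prod s X](_ : _ = [set t : tup | forall i,
    (`[0, 1[%classic `&` B i) (tnth t i)]); last first.
    apply/seteqP; split => t /=; first by move=> [h1 h2] i; split.
    by move=> h; split => i; have [] := h i.
  rewrite (@lebesgue_prod_box _ _ (fun i => `[0, 1[%classic `&` B i)); last first.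
    by move=> i; exact: measurableI.
  rewrite (@lebesgue_prod_box _ _
    (fun i => `[0, 1[%classic `&` (wrap (b 0 i) @^-1` B i))); last first.
    move=> i; apply: measurableI => //; rewrite -[X in measurable X]setTI.
    exact: measurable_wrap.
  by apply: eq_bigr => i _; exact: lebesgue_measure_wrap.
- move=> _; rewrite /= /pushforward /m2 /mrestr preimage_setT setTI.
  by rewrite lebesgue_prod_cube ltry.
Qed.

End CubeRotation.

(** * Measures determined by visit counts *)

Section TorusMeasure.
Context {R : realType} {s : nat}.
Local Notation mR := (measurableTypeR R).
Local Notation tup := (s.-tuple mR).
Implicit Types (B : set (torus R s)) (alpha x : 'rV[R]_s).

Lemma iter_rotation alpha x n :
  iter n (rotation alpha) (torus_proj x) = torus_proj (x + alpha *+ n).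
Proof.
elim: n => [|n IH]; first by rewrite mulr0n addr0.
by rewrite iterS IH /rotation -torus_projD mulrSr addrA.
Qed.

Definition lift_set B : set tup := [set t | B (torus_proj (\row_i tnth t i))].

Lemma lift_set_translate B x :
  [set t : tup | B (torus_proj (\row_i tnth t i + x))] = wrapt x @^-1` lift_set B.
Proof.
apply/seteqP; split => t; rewrite /lift_set /=;
  (rewrite (_ : torus_proj (\row_i tnth t i + x) =
    torus_proj (\row_i tnth (wrapt x t) i)) //; apply/torus_projP;
  apply/mxOverP => i j; rewrite !mxE tnth_mktuple ord1; exact: wrap_int).
Qed.

Lemma torus_measureE B : measurable (lift_set B) ->
  torus_measure B = lebesgue_prod s (cube `&` lift_set B).
Proof.
by move=> mB; apply: measurable_mu_extE; apply: measurableI => //; exact: measurable_cube.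
Qed.

(* Rotations preserve the measure, so integrating the counting function over
   the torus gives [N * torus_measure B]. *)
Lemma torus_measure_of_discrepancy alpha B (rho C : R) :
  measurable (lift_set B) ->
  (forall x (N : nat),
    `| \sum_(n < N) \1_B (torus_proj (x + alpha *+ n)) - N%:R * rho | <= C) ->
  torus_measure B = rho%:E.
Proof.
move=> mB hC; rewrite torus_measureE//.
set mu := lebesgue_prod s; set m := mu _.
have m_fin : m \is a fin_num.
  rewrite ge0_fin_numE ?measure_ge0//.
  rewrite (@le_lt_trans _ _ 1%E) ?ltry// -(@lebesgue_prod_cube R s).
  have mc := @measurable_cube R s.
  apply: le_measure; rewrite ?inE; [exact: measurableI|exact: mc|].
  exact: subIsetl.
rewrite -(fineK m_fin); congr (_%:E); set r := fine m.
pose S n := [set t : tup | B (torus_proj (\row_i tnth t i + alpha *+ n))].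
have mS n : measurable (S n).
  by rewrite /S lift_set_translate -[X in measurable X]setTI; exact: measurable_wrapt.
have muS n : mu (S n `&` cube) = m.
  by rewrite /S lift_set_translate setIC; exact: lebesgue_prod_wrapt.
have intS (N : nat) :
    (\int[mu]_(t in cube) (\sum_(n < N) \1_(S n) t)%:E = (N%:R * r)%:E)%E.
  under eq_integral do rewrite -sumEFin.
  rewrite ge0_integral_sum//; last 2 first.
    exact: measurable_cube.
  - by move=> n; apply/measurable_EFinP; exact: measurable_indic.
  rewrite (eq_bigr (fun=> r%:E)) => [|n _]; last first.
    by rewrite integral_indic ?fineK//; [exact: muS|exact: measurable_cube].
  by rewrite mulr_natl -[in RHS](card_ord N) -sumr_const -sumEFin.
have SE (N : nat) t : \sum_(n < N) \1_(S n) t =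
    \sum_(n < N) \1_B (torus_proj (\row_i tnth t i + alpha *+ n)) :> R.
  apply: eq_bigr => n _; rewrite !indicE.
  by congr ((nat_of_bool _)%:R); apply/idP/idP; rewrite !inE.
have mf (N : nat) : measurable_fun cube
    (fun t : tup => (\sum_(n < N) \1_(S n) t)%:E : \bar R).
  by apply/measurable_EFinP; apply: measurable_sum => n; exact: measurable_indic.
have cstE (c : R) : (\int[mu]_(t in cube) c%:E = c%:E)%E.
  rewrite -[LHS]/(\int[mu]_(t in cube) (cst c%:E) t)%E integral_cst.
    by rewrite -[RHS]mule1; congr (_ * _)%E; exact: lebesgue_prod_cube.
  exact: measurable_cube.
have key (N : nat) : `|N%:R * (r - rho)| <= C.
  rewrite mulrBr ler_norml; apply/andP; split.
    (* Integrals are compared only between nonnegative functions, so a negative lower bound is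
       treated apart. *)
    have [c0|c0] := leP 0 (N%:R * rho - C); last first.
      have : 0 <= N%:R * r by rewrite mulr_ge0// fine_ge0// measure_ge0.
      by lra.
    suff : N%:R * rho - C <= N%:R * r by lra.
    rewrite -lee_fin -intS -cstE; apply: ge0_le_integral => //.
    - exact: measurable_cube.
    - move=> t _; rewrite lee_fin SE.
      by have := hC (\row_i tnth t i) N; rewrite ler_norml; lra.
  suff : N%:R * r <= N%:R * rho + C by lra.
  have h t : \sum_(n < N) \1_(S n) t <= N%:R * rho + C :> R.
    by rewrite SE; have := hC (\row_i tnth t i) N; rewrite ler_norml; lra.
  rewrite -lee_fin -intS -cstE; apply: ge0_le_integral => //.
  - exact: measurable_cube.
  - by move=> t _; rewrite lee_fin sumr_ge0.
  - by move=> t _; rewrite lee_fin; exact: h.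
(* If [r] and [rho] differed, an [N] larger than C / |r - rho| would contradict [key]. *)
apply/eqP; rewrite -subr_eq0; apply/negPn/negP => d0.
have d_gt0 : 0 < `|r - rho| by rewrite normr_gt0.
have := key (Num.bound (C / `|r - rho|)).
rewrite normrM ger0_norm// -ler_pdivlMr// leNgt => /negP; apply.
apply: le_lt_trans (archi_boundP _); rewrite ?divr_ge0// ?(ltW d_gt0)//.
by have := key 0%N; rewrite mul0r normr0.
Qed.

End TorusMeasure.

(** * Strictly increasing integer sequences close to an arithmetic progression *)

Section Counting.
Context {R : realType}.

Lemma int_increasing_lt (u : int -> int) : (forall k, u k < u (k + 1)) ->
  forall k j : int, k < j -> u k < u j.
Proof.
move=> hu k j kj; have [d ->] : exists d : nat, j = k + d.+1%:Z.
  by exists (absz (j - k - 1)%R); lia.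
elim: d {j kj} => [|d IH]; first exact: hu.
by apply: lt_trans IH _; rewrite (_ : d.+2%:Z = d.+1%:Z + 1) ?addrA ?hu//; lia.
Qed.

Lemma int_increasing_addn (u : int -> int) : (forall k, u k < u (k + 1)) ->
  forall k (d : nat), u k + d%:Z <= u (k + d%:Z).
Proof.
move=> hu k; elim=> [|d IH]; first by rewrite !addr0.
rewrite (_ : k + d.+1%:Z = (k + d%:Z) + 1); last by lia.
by have := hu (k + d%:Z); lia.
Qed.

Lemma int_increasing_cross (u : int -> int) : (forall k, u k < u (k + 1)) ->
  exists k : int, u (k - 1) < 0 <= u k.
Proof.
(* From 0 down to [a] the sequence loses at least |u 0| + 1, so it is negative at [a]. *)
move=> hu; pose a : int := - (`|u 0|%N.+1)%:Z.
have ua : u a < 0.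
  have := int_increasing_addn hu a `|u 0|%N.+1.
  by rewrite addNr; move: (u a) (u 0) => x z; lia.
have ex : exists j : nat, 0 <= u (a + j%:Z).
  by exists `|u a|%N; have := int_increasing_addn hu a `|u a|%N; lia.
exists (a + (ex_minn ex)%:Z).
case: ex_minnP => -[|j]; first by rewrite addr0; lia.
move=> -> jmin; rewrite andbT ltNge; apply/negP.
rewrite (_ : _ - 1 = a + j%:Z); last by lia.
by move=> /jmin; rewrite ltnn.
Qed.

Definition nat_range (u : int -> int) : set nat := [set m | exists k, u k = m%:Z].

(** With [k0] and [k] the first indices where [u] reaches 0 and [N], the values of [u] in [0, N[ are
    exactly [u k0], ..., [u (k - 1)]. *)
Lemma sum_indic_nat_range (u : int -> int) : (forall k, u k < u (k + 1)) ->
  exists k0 : int, u (k0 - 1) < 0 <= u k0 /\ forall N : nat, exists k : int,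
    u (k - 1) < N%:Z <= u k /\
    \sum_(m < N) \1_(nat_range u) (m : nat) = (k - k0)%:~R :> R.
Proof.
move=> hu; have [k0 hk0] := int_increasing_cross hu.
exists k0; split=> //; elim=> [|N [k [/andP[k1 k2] IH]]].
  by exists k0; rewrite big_ord0 subrr.
have mono := int_increasing_lt hu.
have [ukN|ukN] := eqVneq (u k) N%:Z.
  exists (k + 1); split.
    by have := hu k; rewrite addrK ukN; lia.
  rewrite big_ord_recr /= IH indicE mem_set; last by exists k.
  by rewrite -[true%:R]/(1%:~R) -intrD; congr (_%:~R); ring.
exists k; split; first by apply/andP; split; lia.
rewrite big_ord_recr /= IH indicE memNset ?addr0// => -[j uj].
have [jk|jk|jk] := ltgtP j k.
- have [jk1|jk1] := eqVneq j (k - 1); first by rewrite -jk1 uj in k1; lia.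
  have /mono : j < k - 1 by lia.
  by lia.
- by have := mono _ _ jk; lia.
- by subst j; move: ukN; rewrite uj eqxx.
Qed.

(** At the first index [i] where [u] reaches [M], (i + y) D lies between M - C and M + C + D.
    Subtracting the cases [M = 0] and [M = N] cancels [y], so the bound is uniform in the phase. *)
Lemma discrepancy_nat_range (u : int -> int) (D C y : R) : 0 < D ->
  (forall k, u k < u (k + 1)) ->
  (forall k, `|(u k)%:~R - (k%:~R + y) * D| <= C) ->
  forall N : nat, `|\sum_(m < N) \1_(nat_range u) (m : nat) - N%:R * D^-1|
    <= (C + C) / D + 1.
Proof.
move=> D0 hu hC N.
have [k0 [/andP[a0 b0] /(_ N)[k [/andP[a b] ->]]]] := sum_indic_nat_range hu.
have bnd (i : int) (M : int) : u (i - 1) < M <= u i ->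
    M%:~R - C <= (i%:~R + y) * D <= M%:~R + C + D.
  move=> /andP[l r].
  have l' : (u (i - 1))%:~R < M%:~R :> R by rewrite ltr_int.
  have r' : M%:~R <= (u i)%:~R :> R by rewrite ler_int.
  have := hC i; have := hC (i - 1); rewrite !ler_norml intrB => /andP[c1 c2] /andP[c3 c4].
  by apply/andP; split; lra.
have /andP[p p1] := bnd k N%:Z (introT andP (conj a b)).
have /andP[p0 p2] := bnd k0 0 (introT andP (conj a0 b0)).
set q := N%:R * D^-1; set e := (C + C) / D.
have qD : q * D = N%:R by rewrite mulfVK// lt0r_neq0.
have eD : e * D = C + C by rewrite mulfVK// lt0r_neq0.
suff : `|((k - k0)%:~R - q) * D| <= (e + 1) * D.
  by rewrite normrM (gtr0_norm D0) ler_pM2r.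
by rewrite ler_norml intrB; apply/andP; split; lra.
Qed.

Lemma sum_indic_bounded_diameter (F : set nat) (c : R) : 0 <= c ->
  (forall m m', F m -> F m' -> m%:R - m'%:R <= c) ->
  forall N : nat, \sum_(m < N) \1_F (m : nat) <= c + 1.
Proof.
move=> c0 hF N.
(* The induction also records a member [m] of [F] such that the count so far is at most N - m; if
   [N] is in [F], this is at most [c]. *)
suff [] : \sum_(m < N) \1_F (m : nat) <= c + 1 :> R /\
    (\sum_(m < N) \1_F (m : nat) = 0 :> R \/
     exists2 m, F m & \sum_(m < N) \1_F (m : nat) <= N%:R - m%:R :> R) by [].
elim: N => [|N [le_c IH]]; first by rewrite big_ord0; split; [lra|left].
rewrite big_ord_recr /= indicE; have [FN|FN] := pselect (F N).
  rewrite mem_set//= -[(N.+1)%:R]natr1.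
  case: IH => [IH|[m Fm IH]]; last first.
    by have := hF _ _ FN Fm => ?; split; [lra|right; exists m => //; lra].
  by rewrite IH; split; [lra|right; exists N => //; lra].
rewrite memNset// addr0; split=> //; case: IH => [|[m Fm IH]]; [by left|right].
by exists m => //; rewrite -natr1; lra.
Qed.

(** Transfers a discrepancy bound from [G] to [B] when they differ only on finitely many sets of
    bounded diameter, here the times spent on faces. *)
Lemma discrepancy_perturb (I : finType) (G B : set nat) (F : I -> set nat)
    (q c e : R) : 0 <= c ->
  (forall m, `|\1_B m - \1_G m| <= \sum_i \1_(F i) m :> R) ->
  (forall i m m', F i m -> F i m' -> m%:R - m'%:R <= c) ->
  (forall N : nat, `|\sum_(m < N) \1_G (m : nat) - N%:R * q| <= e) ->
  forall N : nat,
    `|\sum_(m < N) \1_B (m : nat) - N%:R * q| <= #|I|%:R * (c + 1) + e.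
Proof.
move=> c0 hBG hF hG N.
rewrite -(subrKA (\sum_(m < N) \1_G (m : nat))) (le_trans (ler_normD _ _))//.
apply: lerD; last exact: hG.
rewrite -sumrB (le_trans (ler_norm_sum _ _ _))//.
apply: (@le_trans _ _ (\sum_(m < N) \sum_i \1_(F i) (m : nat))).
  by apply: ler_sum => m _; exact: hBG.
rewrite exchange_big /= mulr_natl -sumr_const; apply: ler_sum => i _.
exact: (sum_indic_bounded_diameter c0 (hF i)).
Qed.

End Counting.

(** * Total irrationality and bases of the lattice *)

Section Irrational.
Context {R : realType} {s : nat}.

Lemma open_nonint : open [set r : R | r \isn't a Num.int].
Proof.
rewrite (_ : mkset _ = \bigcup_(m in [set: int]) `]m%:~R, (m + 1)%:~R[%classic).
  by apply: bigcup_open => m _; exact: itv_open.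
apply/seteqP; split => r /=.
  move=> rZ; exists (Num.floor r) => //=; have /andP[h1 h2] := floor_itv r.
  rewrite in_itv /= h2 andbT lt_neqAle h1 andbT.
  by apply: contraNN rZ => /eqP <-; rewrite intr_int.
move=> [m _] /=; rewrite in_itv /= => /andP[h1 h2]; apply/negP => /intrP[k rk].
by move: h1 h2; rewrite rk !ltr_int; lia.
Qed.

Lemma continuous_dot (w : 'cV[R]_s) : continuous (fun x : 'rV[R]_s => (x *m w) 0 0).
Proof.
rewrite (_ : (fun _ => _) = fun x : 'rV[R]_s => \sum_j x 0 j * w j 0); last first.
  by apply/funext => x; rewrite mxE.
apply: continuous_big => [x|j _ x]; first exact: add_continuous.
apply: cvgMr_tmp; first exact: nbhs_filter.
exact: coord_continuous.
Qed.

(** If [w] were nonzero, the points whose product with [w] is not an integer would form a nonempty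
    open set of the torus. The multiples of [alpha] never enter it, against density. *)
Lemma totally_irrational_int (alpha : 'rV[R]_s) (w : 'cV[R]_s) :
  totally_irrational alpha -> w \is a mxOver Num.int ->
  (alpha *m w) 0 0 \is a Num.int -> w = 0.
Proof.
move=> irr wZ aw; apply/eqP/negPn/negP => w0.
have [j wj] : exists j, w j 0 != 0.
  apply/existsP; apply: contraNT w0; rewrite negb_exists => /forallP h.
  by apply/eqP/colP => j; rewrite mxE; apply/eqP; have := h j; rewrite negbK.
pose O := [set p : torus R s |
  exists2 x, torus_proj x = p & (x *m w) 0 0 \isn't a Num.int].
have dotZ (x y : 'rV[R]_s) : torus_proj x = torus_proj y ->
    (x *m w) 0 0 - (y *m w) 0 0 \is a Num.int.
  move=> /torus_projP/mxOverP xyZ.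
  have -> : (x *m w) 0 0 - (y *m w) 0 0 = ((x - y) *m w) 0 0 by rewrite mulmxBl !mxE.
  rewrite mxE; apply: rpred_sum => k _; apply: rpredM; first exact: xyZ.
  exact: (mxOverP wZ).
have oO : open O.
  rewrite /open /= /quotient_open (_ : _ @^-1` O =
    (fun x => (x *m w) 0 0) @^-1` [set r : R | r \isn't a Num.int]).
    by apply: open_comp open_nonint => x _; exact: continuous_dot.
  apply/seteqP; split => x /=.
    move=> [y yx yZ]; apply: contraNN yZ => xZ.
    rewrite -[(y *m w) 0 0](subrK ((x *m w) 0 0)).
    by rewrite rpredD// dotZ.
  by move=> xZ; exists x.
have [] := irr O _ oO.
  (* The product of this point with [w] is 1/2. *)
  pose x : 'rV[R]_s := \row_k (if k == j then (2 * w j 0)^-1 else 0).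
  exists (torus_proj x), x => //.
  rewrite mxE (bigD1 j)//= big1 => [|k kj]; last by rewrite mxE (negbTE kj) mul0r.
  rewrite mxE eqxx addr0 invfM mulfVK//.
  apply/negP => /intrP[m hm].
  have : (1 : R) = (2 * m)%:~R by rewrite intrM -hm mulfV.
  by move=> /eqP; rewrite -[1]/(1%:~R) eqr_int; lia.
move=> p [[x xp xZ] [n _ /= px]]; move/negP : xZ; apply.
rewrite -[(x *m w) 0 0](subrK ((alpha *+ n *m w) 0 0)).
rewrite rpredD//; first by apply: dotZ; rewrite xp -px.
by rewrite -scaler_nat -scalemxAl mxE rpredM// natr_int.
Qed.

End Irrational.

Section LatticeBasis.
Context {R : realType} {s : nat}.
Implicit Types (alpha : 'rV[R]_s) (w : 'rV[R]_(s + 1)).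

Lemma mulrz_mxE m n (A : 'M[R]_(m, n)) (a : int) i j :
  (A *~ a) i j = a%:~R * A i j.
Proof. by rewrite -scaler_int mxE. Qed.

Lemma mem_lattice alpha w : lattice alpha w <->
  exists n : int, phi w - alpha *~ n \is a mxOver Num.int /\ phi_last w = n%:~R.
Proof.
have E (n : int) (a : 'I_s -> int) :
    row_mx alpha 1 *~ n + \sum_(i < s) delta_mx 0 (lshift 1 i) *~ a i =
    row_mx (alpha *~ n + \row_i (a i)%:~R) (n%:~R)%:M.
  apply/rowP => j; rewrite mxE summxE mulrz_mxE.
  under eq_bigr do rewrite mulrz_mxE mxE eqxx /=.
  case: (splitP j) => i ji.
    have -> : j = lshift 1 i by exact: val_inj.
    rewrite !row_mxEl !mxE mulrz_mxE (bigD1 i)//= eqxx mulr1 big1 ?addr0// => k ki.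
    by rewrite eq_lshift eq_sym (negbTE ki) mulr0.
  have -> : j = rshift s i by exact: val_inj.
  rewrite !row_mxEr !mxE big1 ?addr0 => [|k _].
    by rewrite ord1 eqxx mulr1.
  by rewrite eq_rlshift mulr0.
split.
  move=> [n _ [a _ <-]]; exists n; rewrite E /phi /phi_last row_mxKl row_mxEr !mxE eqxx.
  split=> //; rewrite addrC addKr; apply/mxOverP => i j; rewrite mxE; exact: intr_int.
move=> [n [/mxOverP zZ wn]].
exists n => //; exists (fun i => Num.floor ((phi w - alpha *~ n) 0 i)) => //.
rewrite E -[RHS]hsubmxK; congr row_mx.
  apply/rowP => i; rewrite mxE [(\row__ _) _ _]mxE (floorK (zZ _ _)).
  by rewrite !mxE addrC subrK.
by apply/rowP => i; rewrite !mxE !ord1 eqxx -wn.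
Qed.

Variables (alpha : 'rV[R]_s) (v : 'I_(s + 1) -> 'rV[R]_(s + 1)).
Hypothesis vB : Zbasis (lattice alpha) v.

Let V := \matrix_i v i.

(** The rows are the defining generators of the lattice: the first [s] unit vectors, then (alpha,
    1). *)
Definition std_basis_mx : 'M[R]_(s + 1) := block_mx 1%:M 0 alpha 1%:M.

Lemma lattice_std_basis i : lattice alpha (row i std_basis_mx).
Proof.
apply/mem_lattice; rewrite /phi /phi_last /std_basis_mx /block_mx.
case: (split_ordP i) => k ->; rewrite ?rowKu ?rowKd row_row_mx row_mxKl row_mxEr.
  exists 0; rewrite mulr0z subr0 !mxE; split=> //; apply/mxOverP => ? ?.
  by rewrite !mxE natr_int.
exists 1; rewrite mulr1z !mxE ord1 eqxx; split=> //; apply/mxOverP => a b.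
by rewrite !mxE !ord1 subrr rpred0.
Qed.

Lemma std_basis_mx_unit : std_basis_mx \in unitmx.
Proof. by rewrite unitmxE det_lblock !det1 mulr1 unitr1. Qed.

Lemma lattice_integral (m : nat) (W : 'M[R]_(m, s + 1)) :
  (forall i, lattice alpha (row i W)) ->
  exists2 M : 'M[R]_(m, s + 1), M \is a mxOver Num.int & W = M *m V.
Proof.
move=> /(_ _)/(proj2 vB) => h.
have /choice[c hc] : forall i, exists c : {ffun 'I_(s + 1) -> int},
    row i W = \sum_j v j *~ c j.
  by move=> i; have [c [? _]] := h i; exists c.
exists (\matrix_(i, j) (c i j)%:~R); first by apply/mxOverP => i j; rewrite mxE intr_int.
apply/row_matrixP => i; rewrite hc row_mul mulmx_sum_row.
by apply: eq_bigr => j _; rewrite rowK !mxE scaler_int.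
Qed.

Lemma Zbasis_std_basis :
  exists2 M : 'M[R]_(s + 1), M \is a mxOver Num.int & std_basis_mx = M *m V.
Proof. exact: lattice_integral lattice_std_basis. Qed.

Lemma Zbasis_unitmx : V \in unitmx.
Proof.
have [M _ BE] := Zbasis_std_basis; have := std_basis_mx_unit.
by rewrite BE unitmx_mul => /andP[].
Qed.

Lemma Zbasis_mx_std_basis :
  exists2 M : 'M[R]_(s + 1), M \is a mxOver Num.int & V = M *m std_basis_mx.
Proof.
(* The last coordinate of [v i] is its coefficient on (alpha, 1); what remains is an integer
   vector. *)
exists (row_mx (lsubmx V - rsubmx V *m alpha) (rsubmx V)).
  apply/mxOverP => i j.
  have [n [/mxOverP zZ wn]] := (mem_lattice alpha (v i)).1 (vB.1 i).
  have VE : V i (rshift s 0) = n%:~R by rewrite mxE.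
  case: (split_ordP j) => k ->; rewrite ?row_mxEl ?row_mxEr; last first.
    by rewrite mxE (ord1 k) VE intr_int.
  have := zZ 0 k; rewrite !mxE big_ord1 !mxE mulrz_mxE -wn; apply.
rewrite /std_basis_mx mul_row_block !mulmx1 mulmx0 add0r subrK.
by rewrite hsubmxK.
Qed.

(** The row (-alpha, 1) times [std_basis_mx] is (0, 1), so [q] is [p] times (-alpha, 1) times the
    integer matrix [M]. If [p] is nonzero, [q *m z = 0] makes the product of [alpha] with an integer
    vector an integer. Irrationality then gives [M *m z = 0], and [z = 0] because [M] is
    invertible. *)
Lemma int_relation_height (q : 'rV[R]_(s + 1)) (p : R) (z : 'cV[R]_(s + 1)) :
  totally_irrational alpha -> q *m V = row_mx 0 p%:M ->
  z \is a mxOver Num.int -> z != 0 -> q *m z = 0 -> p = 0.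
Proof.
move=> irr qV zZ z0 qz; apply/eqP; apply: contraNT z0 => p0.
have [M MZ BE] := Zbasis_std_basis; have [M' M'Z VE] := Zbasis_mx_std_basis.
have Vu := Zbasis_unitmx.
have M'M : M' *m M = 1%:M.
  by apply: (can_inj (mulmxK Vu)); rewrite -mulmxA -BE -VE mul1mx.
have qE : q = p *: (row_mx (- alpha) 1%:M *m M).
  apply: (can_inj (mulmxK Vu)); rewrite qV -scalemxAl -mulmxA -BE /std_basis_mx.
  rewrite mul_row_block mulmx1 mulmx0 add0r !mul1mx addNr scale_row_mx scaler0.
  by rewrite scale_scalar_mx mulr1.
pose w := M *m z.
have wZ : w \is a mxOver Num.int by exact: mxOverM.
have /eqP : p *: (row_mx (- alpha) 1%:M *m w) = 0 by rewrite mulmxA scalemxAl -qE.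
rewrite scaler_eq0 (negbTE p0) /= -(vsubmxK w) mul_row_col mul1mx mulNmx addrC.
rewrite subr_eq0 => /eqP wE.
have wu : usubmx w = 0.
  apply: (totally_irrational_int irr); last by rewrite -wE mxE; exact: (mxOverP wZ).
  by apply/mxOverP => i j; rewrite mxE; exact: (mxOverP wZ).
have w0 : w = 0 by rewrite -(vsubmxK w) wE wu mulmx0 col_mx0.
by rewrite -(mul1mx z) -M'M -mulmxA -/w w0 mulmx0.
Qed.

End LatticeBasis.

(** * Visits to the parallelotope *)

Section SpecialRegion.
Context {R : realType} {s : nat}.
Variables (alpha : 'rV[R]_s) (v : 'I_(s + 1) -> 'rV[R]_(s + 1)).
Hypothesis irr : totally_irrational alpha.
Hypothesis vB : Zbasis (lattice alpha) v.
Let v_ (i : 'I_s) := v (lshift 1 i).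
Let v_last := v (rshift s ord0).
Hypothesis S4 :
  forall I : {set 'I_s}, 0 < phi_last v_last - \sum_(i in I) phi_last (v_ i).

Definition edge_mx : 'M[R]_s := \matrix_i phi (v_ i).

(* [edge_coord x i] is the coefficient of [phi (v_ i)] in the expansion of [x]. *)
Definition edge_coord (x : 'rV[R]_s) (i : 'I_s) : R := (x *m invmx edge_mx) 0 i.

Let V := \matrix_i v i.
Let tau := edge_coord (phi v_last).
Let h i := phi_last (v_ i).

Lemma usubmxV : usubmx V = row_mx edge_mx (\col_i h i).
Proof.
rewrite -[LHS]hsubmxK; congr row_mx.
  by apply/matrixP => i j; rewrite !mxE.
by apply/colP => i; rewrite !mxE.
Qed.

Lemma dsubmxV : dsubmx V = row_mx (phi v_last) (phi_last v_last)%:M.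
Proof.
rewrite -[LHS]hsubmxK; congr row_mx.
  by apply/rowP => i; rewrite !mxE.
by apply/rowP => i; rewrite !mxE !ord1 eqxx.
Qed.

Lemma mul_row_V (t : 'rV[R]_s) (a : R) :
  row_mx t a%:M *m V = row_mx (t *m edge_mx + a *: phi v_last)
    (\sum_i t 0 i * h i + a * phi_last v_last)%:M.
Proof.
rewrite -{1}(vsubmxK V) mul_row_col usubmxV dsubmxV !mul_mx_row add_row_mx.
rewrite !mul_scalar_mx; congr row_mx; apply/rowP => i.
rewrite !mxE !ord1 eqxx; congr (_ + _).
by apply: eq_bigr => j _; rewrite mxE.
Qed.

(** If [t] kills [edge_mx], then (t, 0) times [V] has only a last coordinate. The last unit column
    kills (t, 0), so [int_relation_height] makes that coordinate vanish too, and [V] is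
    invertible. *)
Lemma edge_mx_unit : edge_mx \in unitmx.
Proof.
rewrite -row_free_unit; apply: inj_row_free => t tE.
have E := mul_row_V t 0; rewrite tE scale0r addr0 mul0r addr0 in E.
have z0 : (col_mx 0 1%:M : 'cV[R]_(s + 1)) != 0.
  by rewrite col_mx_eq0 negb_and [X in _ || X]oner_neq0 orbT.
have p0 : \sum_i t 0 i * h i = 0.
  apply: (int_relation_height vB irr E _ z0).
    apply/mxOverP => i j; case: (split_ordP i) => k ->.
      by rewrite col_mxEu mxE.
    by rewrite col_mxEd mxE natr_int.
  by rewrite mul_row_col mulmx0 mulmx1 raddf0 addr0.
have : row_mx t 0%:M = 0 :> 'rV[R]_(s + 1).
  apply: (can_inj (mulmxK (Zbasis_unitmx vB))).
  by rewrite E p0 mul0mx raddf0 row_mx0.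
by move=> /eqP; rewrite row_mx_eq0 => /andP[/eqP].
Qed.

Lemma edge_coordK x : x = \sum_i edge_coord x i *: phi (v_ i).
Proof.
rewrite -{1}(mulmxKV edge_mx_unit x) mulmx_sum_row.
by apply: eq_bigr => i _; rewrite rowK.
Qed.

Lemma edge_coord_sum (t : 'I_s -> R) i :
  edge_coord (\sum_j t j *: phi (v_ j)) i = t i.
Proof.
rewrite /edge_coord (_ : \sum_j _ = (\row_j t j) *m edge_mx).
  by rewrite mulmxK ?edge_mx_unit// mxE.
by rewrite mulmx_sum_row; apply: eq_bigr => j _; rewrite rowK mxE.
Qed.

Lemma edge_coordD x y i : edge_coord (x + y) i = edge_coord x i + edge_coord y i.
Proof. by rewrite /edge_coord mulmxDl mxE. Qed.

Lemma edge_coordZ a x i : edge_coord (a *: x) i = a * edge_coord x i.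
Proof. by rewrite /edge_coord -scalemxAl mxE. Qed.

(** The vector obtained from [v_last] by subtracting its components [tau i] along the edges [v_ i]
    is vertical. Its height is the step D of the arithmetic progression. *)
Definition slope : R := phi_last v_last - \sum_i tau i * h i.

Lemma tau_row : \row_i tau i *m edge_mx = phi v_last.
Proof.
rewrite -[RHS](mulmxKV edge_mx_unit); congr (_ *m _).
by apply/rowP => i; rewrite mxE.
Qed.

(** The row (tau, -1) times [V] is (0, -slope), and the relation says that this row kills the
    integer column (b e_i, -a). If [b] were nonzero, [int_relation_height] would give slope 0. *)
Lemma tau_irrational (a b : int) i : slope != 0 ->
  a%:~R + b%:~R * tau i = 0 -> b = 0.
Proof.
move=> D0 ab; apply/eqP; apply: contraNT D0 => b0.
have E : row_mx (\row_i tau i) (- 1)%:M *m V =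
    row_mx 0 (\sum_i tau i * h i - phi_last v_last)%:M.
  rewrite mul_row_V tau_row scaleN1r subrr mulN1r; congr (row_mx _ (_ - _)%:M).
  by apply: eq_bigr => k _; rewrite mxE.
suff p0 : \sum_i tau i * h i - phi_last v_last = 0.
  by rewrite /slope (subr0_eq p0) subrr.
apply: (int_relation_height vB irr E (z := col_mx (b%:~R *: delta_mx i 0) (- a%:~R)%:M)).
- apply/mxOverP => k l; case: (split_ordP k) => m ->.
    by rewrite col_mxEu !mxE rpredM// ?intr_int ?natr_int.
  by rewrite col_mxEd mxE rpredMn// rpredN intr_int.
- rewrite col_mx_eq0 negb_and scaler_eq0 negb_or intr_eq0 b0 /=.
  apply/orP; left; apply/eqP => /matrixP/(_ i 0); rewrite !mxE !eqxx.
  by apply/eqP; rewrite oner_neq0.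
rewrite mul_row_col -scalemxAr -scalar_mxM mulN1r opprK.
rewrite -colE; apply/rowP => k; rewrite !mxE !ord1 eqxx mulr1n addrC.
by [].
Qed.

Definition lattice_pt (c : 'I_(s + 1) -> int) : 'rV[R]_(s + 1) := \sum_j v j *~ c j.

Lemma lattice_ptE c : lattice_pt c =
  \sum_i (c (lshift 1 i))%:~R *: v_ i + (c (rshift s ord0))%:~R *: v_last.
Proof.
rewrite /lattice_pt big_split_ord big_ord1 /=; congr (_ + _).
  by apply: eq_bigr => i _; rewrite scaler_int.
by rewrite scaler_int.
Qed.

Lemma edge_coord_lattice_pt c i : edge_coord (phi (lattice_pt c)) i =
  (c (lshift 1 i))%:~R + (c (rshift s ord0))%:~R * tau i.
Proof.
rewrite lattice_ptE /phi linearD linearZ linear_sum /=.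
rewrite edge_coordD edge_coordZ; congr (_ + _).
under eq_bigr do rewrite linearZ /=.
exact: (edge_coord_sum (fun j => (c (lshift 1 j))%:~R)).
Qed.

(** Shows that the height is the coefficient of [v_last] times [slope], up to a term controlled by
    the position of the projection. *)
Lemma phi_last_lattice_pt c : phi_last (lattice_pt c) =
  (c (rshift s ord0))%:~R * slope + \sum_i edge_coord (phi (lattice_pt c)) i * h i.
Proof.
rewrite /slope mulrBr mulr_sumr addrAC -addrA -sumrB.
rewrite lattice_ptE /phi_last mxE summxE mxE addrC; congr (_ + _).
apply: eq_bigr => i _; rewrite -lattice_ptE edge_coord_lattice_pt mxE.
by rewrite mulrDl mulrA addrK.
Qed.

Lemma phi_last_lattice_ptD c : phi_last (lattice_pt c) =
  \sum_i (c (lshift 1 i))%:~R * h i + (c (rshift s ord0))%:~R * phi_last v_last.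
Proof.
rewrite lattice_ptE /phi_last mxE summxE mxE; congr (_ + _).
by apply: eq_bigr => i _; rewrite mxE.
Qed.

Lemma lattice_lattice_pt c : lattice alpha (lattice_pt c).
Proof.
have /choice[n hn] j := (mem_lattice alpha (v j)).1 (vB.1 j).
apply/mem_lattice; exists (\sum_j n j * c j); split; last first.
  rewrite /phi_last summxE raddf_sum; apply: eq_bigr => j _ /=.
  by rewrite mulrz_mxE [v j _ _](hn j).2 intrM mulrC.
apply/mxOverP => a b; rewrite /phi linear_sum /= mulrz_sumr -sumrB summxE.
apply: rpred_sum => j _; rewrite raddfMz /= mulrzA -mulrzBl mulrz_mxE.
by rewrite rpredM ?intr_int// (mxOverP (hn j).1).
Qed.

Lemma phi_last_int j : phi_last (v j) = (Num.floor (phi_last (v j)))%:~R.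
Proof.
have [n [_ ->]] := (mem_lattice alpha (v j)).1 (vB.1 j).
by rewrite intrKfloor.
Qed.

(** The lattice points of height [m] project exactly onto the integer translates of m alpha, so
    visits at time [m] are lattice points of height [m]. *)
Lemma orbit_mem (S : set 'rV[R]_s) x (m : nat) :
  (@torus_proj R s @` S) (torus_proj (x + alpha *+ m)) <->
  exists2 c, phi_last (lattice_pt c) = m%:R & S (x + phi (lattice_pt c)).
Proof.
split.
  move=> [p Sp /torus_projP pxZ].
  pose w : 'rV[R]_(s + 1) := row_mx (p - x) (m%:R)%:M.
  have : lattice alpha w.
    apply/mem_lattice; exists m; rewrite /phi /phi_last row_mxKl row_mxEr mxE eqxx.
    by rewrite -addrA -opprD.
  move=> /(vB.2 w)[c [wE _]]; exists c; rewrite /lattice_pt -wE.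
    by rewrite /phi_last row_mxEr mxE eqxx.
  by rewrite /phi row_mxKl addrC subrK.
move=> [c cm Sc]; exists (x + phi (lattice_pt c)) => //; apply/torus_projP.
have /mem_lattice[n [nZ]] := lattice_lattice_pt c.
rewrite cm => /eqP; rewrite -[m%:R]/(m%:~R) eqr_int => /eqP nm.
by move: nZ; rewrite -nm opprD addrACA subrr add0r.
Qed.

(** This is what (S2) gives, since the region lies in the closed parallelotope. *)
Hypothesis tau01 : forall i, 0 <= tau i <= 1.

(** As each [tau i] is in [0, 1], the sum of the [tau i * h i] is at most the sum of the positive
    [h i], to which (S4) applies. *)
Lemma slope_gt0 : 0 < slope.
Proof.
apply: lt_le_trans (S4 [set i | 0 < h i]%SET) _.
rewrite lerD2l lerN2 [leRHS](big_mkcond (fun i => i \in _)) /=.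
apply: ler_sum => i _; rewrite inE; have /andP[t0 t1] := tau01 i.
case: ltP => hi; last exact: mulr_ge0_le0.
by rewrite -[leRHS]mul1r ler_wpM2r// ltW.
Qed.

(** An endpoint value would be an integer relation excluded by [tau_irrational]. *)
Lemma tau_itv i : 0 < tau i < 1.
Proof.
have D0 := lt0r_neq0 slope_gt0; have /andP[t0 t1] := tau01 i.
rewrite !lt_neqAle t0 t1 !andbT; apply/andP; split.
  apply/eqP => t; have := @tau_irrational 0 1 i D0; rewrite -t mulr0 addr0.
  by move=> /(_ erefl).
apply/eqP => t; have := @tau_irrational (- 1) 1 i D0.
by rewrite t mulr1 addNr => /(_ erefl).
Qed.

Definition height_bound : R := \sum_i `|h i|.

Lemma le_height_bound (t : 'I_s -> R) : (forall i, `|t i| <= 1) ->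
  `|\sum_i t i * h i| <= height_bound.
Proof.
move=> t1; rewrite (le_trans (ler_norm_sum _ _ _))//; apply: ler_sum => i _.
by rewrite normrM ler_piMl.
Qed.

(* For each coefficient [k] of [v_last] this is the lattice point which moves
   [x] into the half-open parallelotope. *)
Definition strip_coef (x : 'rV[R]_s) (k : int) (j : 'I_(s + 1)) : int :=
  match fintype.split j with
  | inl i => - Num.floor (edge_coord x i + k%:~R * tau i)
  | inr _ => k
  end.

(** The heights of the basis vectors are integers embedded in [R]; [Num.floor] recovers them as
    elements of [int]. *)
Definition strip_height (x : 'rV[R]_s) (k : int) : int :=
  \sum_j strip_coef x k j * Num.floor (phi_last (v j)).

Lemma strip_coefl x k i :
  strip_coef x k (lshift 1 i) = - Num.floor (edge_coord x i + k%:~R * tau i).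
Proof. by rewrite /strip_coef (unsplitK (inl i)). Qed.

Lemma strip_coefr x k : strip_coef x k (rshift s ord0) = k.
Proof. by rewrite /strip_coef (unsplitK (inr ord0)). Qed.

Lemma phi_last_lattice_ptE c :
  phi_last (lattice_pt c) = (\sum_j c j * Num.floor (phi_last (v j)))%:~R.
Proof.
rewrite /phi_last /lattice_pt summxE raddf_sum; apply: eq_bigr => j _ /=.
by rewrite mulrz_mxE intrM -phi_last_int.
Qed.

Lemma strip_heightE x k :
  (strip_height x k)%:~R = phi_last (lattice_pt (strip_coef x k)).
Proof. by rewrite phi_last_lattice_ptE. Qed.

Definition strip_coord x k i := edge_coord (x + phi (lattice_pt (strip_coef x k))) i.

Lemma strip_coordE x k i : strip_coord x k i =
  edge_coord x i + k%:~R * tau i - (Num.floor (edge_coord x i + k%:~R * tau i))%:~R.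
Proof.
rewrite /strip_coord edge_coordD edge_coord_lattice_pt strip_coefl strip_coefr.
by rewrite mulrNz addrCA addrC.
Qed.

Lemma strip_coord_itv x k i : 0 <= strip_coord x k i < 1.
Proof.
rewrite strip_coordE; have := floor_itv (edge_coord x i + k%:~R * tau i).
by rewrite intrD1 => /andP[? ?]; apply/andP; split; lra.
Qed.

(* The two coordinates differ by [tau i] up to an integer, and [tau i] lies
   in ]0, 1[, so the integer is 0 or -1: this is where (S4) enters. *)
Lemma strip_height_increasing x k : strip_height x k < strip_height x (k + 1).
Proof.
rewrite -(ltr_int R) !strip_heightE -subr_gt0.
pose fl (j : int) i := Num.floor (edge_coord x i + j%:~R * tau i).
have step i : fl (k + 1) i - fl k i = (fl (k + 1) i != fl k i)%:R :> int.
  have /andP[a1 a2] := floor_itv (edge_coord x i + k%:~R * tau i).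
  have /andP[b1 b2] := floor_itv (edge_coord x i + (k + 1)%:~R * tau i).
  rewrite -/(fl k i) in a1 a2; rewrite -/(fl (k + 1) i) in b1 b2.
  have /andP[t0 t1] := tau_itv i.
  have c1 : (fl k i)%:~R < (fl (k + 1) i + 1)%:~R :> R.
    by move: b2; rewrite !intrD1; lra.
  have c2 : (fl (k + 1) i)%:~R < (fl k i + 2)%:~R :> R.
    by move: b1 a2; rewrite !intrD; lra.
  by move: c1 c2; rewrite !ltr_int; case: eqVneq => /=; lia.
(* (S4) is used for the set of coordinates whose floor jumps. *)
have := S4 [set i | fl (k + 1) i != fl k i]%SET.
congr (_ < _); rewrite !phi_last_lattice_ptD !strip_coefr.
rewrite opprD addrACA -mulrBl intrD1 (addrC k%:~R) addrK mul1r [RHS]addrC.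
congr (_ + _); rewrite -sumrB big_mkcond /= -sumrN; apply: eq_bigr => i _.
rewrite !strip_coefl -mulrBl -intrB -opprD -/(fl k i) -/(fl (k + 1) i).
rewrite mulrNz mulNr; congr (- _).
rewrite step inE; case: eqVneq => _; rewrite ?mul0r ?mul1r//.
Qed.

(** The phase [y] of [discrepancy_nat_range]; the progression depends on [x] through it alone. *)
Definition strip_offset x : R := - (\sum_i edge_coord x i * h i) / slope.

Lemma phi_last_strip x c :
  phi_last (lattice_pt c) - ((c (rshift s ord0))%:~R + strip_offset x) * slope =
  \sum_i edge_coord (x + phi (lattice_pt c)) i * h i.
Proof.
rewrite phi_last_lattice_pt mulrDl divfK ?lt0r_neq0 ?slope_gt0//.
rewrite opprD opprK addrACA subrr add0r -big_split /=.
by apply: eq_bigr => i _; rewrite -mulrDl -edge_coordD addrC.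
Qed.

Lemma strip_height_bound x k :
  `|(strip_height x k)%:~R - (k%:~R + strip_offset x) * slope| <= height_bound.
Proof.
rewrite strip_heightE -{2}(strip_coefr x k) phi_last_strip.
apply: le_height_bound => i.
by have /andP[t0 t1] := strip_coord_itv x k i; rewrite ger0_norm// ltW.
Qed.

(** Whatever the choice of boundary, the region lies between [open_box] and [closed_box]. *)
Definition open_box : set 'rV[R]_s := [set x | forall i, 0 < edge_coord x i < 1].
Definition closed_box : set 'rV[R]_s := [set x | forall i, 0 <= edge_coord x i <= 1].

(* Times at which the orbit of [x] meets a face of the parallelotope parallel
   to all edges but the [i]-th. *)
Definition face_times x (i : 'I_s) : set nat :=
  [set m | exists c, [/\ phi_last (lattice_pt c) = m%:R,
    closed_box (x + phi (lattice_pt c)) &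
    edge_coord (x + phi (lattice_pt c)) i \is a Num.int]].

(** Two visits with integer [i]-th coordinate give an integer relation for [tau i], which forces
    equal coefficients of [v_last]. Both heights are then within [height_bound] of the same
    number. *)
Lemma face_times_diameter x i m m' : face_times x i m -> face_times x i m' ->
  m%:R - m'%:R <= height_bound + height_bound.
Proof.
move=> [c [cm cK ci]] [d [dm dK di]].
have D0 := lt0r_neq0 slope_gt0.
have cd : c (rshift s ord0) = d (rshift s ord0).
  have /intrP[n] := rpredB ci di; rewrite !edge_coordD !edge_coord_lattice_pt => E.
  apply/eqP; rewrite -subr_eq0; apply/eqP.
  apply: (@tau_irrational (c (lshift 1 i) - d (lshift 1 i) - n) _ i D0).
  by rewrite !intrB -E; ring.
have bnd e : closed_box (x + phi (lattice_pt e)) ->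
    `|phi_last (lattice_pt e) - ((e (rshift s ord0))%:~R + strip_offset x) * slope|
    <= height_bound.
  move=> eK; rewrite phi_last_strip; apply: le_height_bound => j.
  by have /andP[? ?] := eK j; rewrite ger0_norm.
have := bnd _ cK; have := bnd _ dK; rewrite -cd cm dm !ler_norml.
by move=> /andP[? ?] /andP[? ?]; lra.
Qed.

(** Away from the face times every visit to the closed box is interior, so visits to [S] and heights
    of strip points coincide; at a face time the right side is at least 1. *)
Lemma indic_strip_face (S : set 'rV[R]_s) x m :
  open_box `<=` S -> S `<=` closed_box ->
  `|\1_(@torus_proj R s @` S) (torus_proj (x + alpha *+ m)) -
    \1_(nat_range (strip_height x)) m| <= \sum_i \1_(face_times x i) m :> R.
Proof.
move=> US SK.
have [[i Fi]|noF] := pselect (exists i, face_times x i m).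
  rewrite (bigD1 i)//= [X in _ <= X + _]indicE mem_set//.
  rewrite (@le_trans _ _ 1)//; last by rewrite lerDl sumr_ge0.
  rewrite !indicE; do 2 case: (_ \in _);
    by rewrite ?subrr ?subr0 ?sub0r ?normrN ?normr0 ?normr1.
rewrite big1 => [|i _]; last by rewrite indicE memNset// => Fi; apply: noF; exists i.
suff E : (@torus_proj R s @` S) (torus_proj (x + alpha *+ m)) <->
    nat_range (strip_height x) m.
  by rewrite !indicE (_ : _ \in _ = (m \in nat_range (strip_height x)))
    ?subrr ?normr0//; apply/idP/idP; rewrite !inE => /E.
rewrite orbit_mem; split.
  move=> [c cm Sc]; have cK := SK _ Sc.
  exists (c (rshift s ord0)); apply/eqP; rewrite -(eqr_int R) strip_heightE.
  rewrite -[m%:~R]/(m%:R) -cm; apply/eqP; congr (phi_last (lattice_pt _)).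
  (* Since the coordinates lie in [0, 1[, the coefficients of [c] on the edges must be those of
     [strip_coef]. *)
  apply/funext => j; case: (split_ordP j) => i ->; last first.
    by rewrite (ord1 i) strip_coefr.
  have /andP[c0 c1] := cK i.
  have c_lt1 : edge_coord (x + phi (lattice_pt c)) i < 1.
    rewrite lt_neqAle c1 andbT; apply/eqP => c_eq1; apply: noF; exists i, c.
    by rewrite c_eq1 rpred1.
  rewrite strip_coefl; apply/eqP; rewrite -subr_eq0 -opprD oppr_eq0 addr_eq0.
  move: c0 c_lt1; rewrite edge_coordD edge_coord_lattice_pt => c0 c_lt1.
  apply/eqP/floor_def; rewrite intrD1 mulrNz; apply/andP; split; lra.
move=> [k km].
have cm : phi_last (lattice_pt (strip_coef x k)) = m%:R by rewrite -strip_heightE km.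
exists (strip_coef x k) => //; apply: US => i.
have /andP[t0 t1] := strip_coord_itv x k i; rewrite -/(strip_coord x k i) t1 andbT.
rewrite lt_neqAle t0 andbT; apply/eqP => t_eq0; apply: noF; exists i, (strip_coef x k).
split=> //; last by rewrite -/(strip_coord x k i) -t_eq0 rpred0.
by move=> j; have /andP[-> /ltW] := strip_coord_itv x k j.
Qed.

(** The bound is uniform in [x], [N] and [S]: it serves both for averaging over the torus and for
    the region itself. *)
Lemma discrepancy_region (S : set 'rV[R]_s) x (N : nat) :
  open_box `<=` S -> S `<=` closed_box ->
  `|\sum_(m < N) \1_(@torus_proj R s @` S) (torus_proj (x + alpha *+ m))
    - N%:R * slope^-1| <=
  #|'I_s|%:R * (height_bound + height_bound + 1) +
  ((height_bound + height_bound) / slope + 1).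
Proof.
move=> US SK.
pose B := [set m : nat | (@torus_proj R s @` S) (torus_proj (x + alpha *+ m))].
rewrite (_ : \sum_(m < N) _ = \sum_(m < N) \1_B (m : nat)); last first.
  apply: eq_bigr => m _; rewrite !indicE.
  by congr ((nat_of_bool _)%:R); apply/idP/idP; rewrite !inE.
apply: (@discrepancy_perturb R _ (nat_range (strip_height x)) B (face_times x)).
- by rewrite addr_ge0// sumr_ge0.
- move=> m; rewrite (_ : \1_B m =
      \1_(@torus_proj R s @` S) (torus_proj (x + alpha *+ m)));
    first exact: indic_strip_face.
  by rewrite !indicE; congr ((nat_of_bool _)%:R); apply/idP/idP; rewrite !inE.
- exact: face_times_diameter.
- move=> M; apply: discrepancy_nat_range.
  + exact: slope_gt0.
  + exact: strip_height_increasing.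
  + exact: strip_height_bound.
Qed.

(** The lift is a countable union over integer translates of finite intersections of preimages under
    affine maps. *)
Lemma measurable_box_preimage (b : R -> Prop) :
  @measurable _ (measurableTypeR R) [set r | b r] ->
  measurable (lift_set (@torus_proj R s @` [set x | forall i, b (edge_coord x i)])).
Proof.
move=> mb.
rewrite (_ : lift_set _ = \bigcup_(z in [set: 'rV[int]_s])
    [set t : s.-tuple (measurableTypeR R) |
      forall i, b (edge_coord (\row_j tnth t j + map_mx intr z) i)]); last first.
  apply/seteqP; split => t.
    move=> [p bp /torus_projP/mxOverP ptZ].
    exists (map_mx Num.floor (p - \row_j tnth t j)) => // i.
    rewrite (_ : _ + _ = p) ?bp//; apply/rowP => j.
    have := ptZ 0 j; rewrite !mxE => /floorK ->.
    by rewrite addrC subrK.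
  move=> [z _ bz]; exists (\row_j tnth t j + map_mx intr z) => //.
  apply/torus_projP/mxOverP => i j; rewrite !mxE addrC addKr.
  exact: intr_int.
apply: countable_bigcupT_measurable; first exact: countableP.
move=> z.
rewrite (_ : mkset _ = \bigcap_(i in [set: 'I_s])
   ((fun t : s.-tuple (measurableTypeR R) =>
      edge_coord (\row_j tnth t j + map_mx intr z) i : measurableTypeR R)
      @^-1` [set r | b r])); last first.
  by apply/seteqP; split => t /= hb i; [move=> _|]; exact: hb.
apply: fin_bigcap_measurable; first exact: finite_finset.
move=> i _; rewrite -[X in measurable X]setTI.
have mf : measurable_fun setT (fun t : s.-tuple (measurableTypeR R) =>
      edge_coord (\row_j tnth t j + map_mx intr z) i : measurableTypeR R).
  rewrite (_ : (fun _ => _) = fun t : s.-tuple (measurableTypeR R) =>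
    \sum_j (tnth t j + (z 0 j)%:~R) * invmx edge_mx j i); last first.
    by apply/funext => t; rewrite /edge_coord mxE; apply: eq_bigr => j _; rewrite !mxE.
  apply: measurable_sum => j; apply: measurable_funM => //.
  by apply: measurable_funD => //; exact: measurable_tnth.
exact: mf.
Qed.

End SpecialRegion.

(** * Measure and discrepancy of the special region *)

Lemma le_torus_measure (R : realType) (s : nat) :
  {homo @torus_measure R s : A B / A `<=` B >-> (A <= B)%E}.
Proof.
move=> A B AB; apply: le_mu_ext => t.
by move=> [t01 At]; split=> //; exact: AB.
Qed.

Theorem theorem1p2 (R : realType) (s : nat) (hs : (0 < s)%N)
    (alpha : 'rV[R]_s) (halpha : totally_irrational alpha)
    (A : set 'rV[R]_s) (hA : special_region alpha A) :
  bounded_remainder_set alpha (@torus_proj R s @` A).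
Proof.
have [v /= [[P [fP PK Pu] AE] Alast vB S4]] := hA.
have phi_sum (t : 'I_s -> R) :
    phi (\sum_i t i *: v (lshift 1 i)) = \sum_i t i *: phi (v (lshift 1 i)).
  by rewrite /phi linear_sum; apply: eq_bigr => i _; rewrite linearZ.
have coordE := edge_coord_sum halpha vB.
have AK : A `<=` closed_box v.
  rewrite AE => _ [p /PK [t /= t01 <-] <-] i.
  by rewrite phi_sum coordE.
(* Some point of [P] is congruent to the given point modulo the edges. Its coordinates lie in
   [0, 1], so they cannot differ from numbers in ]0, 1[ by nonzero integers. *)
have UA : open_box v `<=` A.
  move=> x xU; have [p [[Pp [c cE]] _]] := Pu (edge_coord v x).
  rewrite AE; exists p => //.
  have [t /= t01 pE] := PK p Pp.
  have tE i : edge_coord v x i = t i + (c i)%:~R.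
    rewrite -[LHS](coordE (edge_coord v x)) -phi_sum cE -pE.
    rewrite -[RHS](coordE (fun j => t j + (c j)%:~R)).
    rewrite -phi_sum; congr (edge_coord v (phi _) i); rewrite -big_split /=.
    by apply: eq_bigr => j _; rewrite scalerDl scaler_int.
  rewrite [RHS](edge_coordK halpha vB) -pE phi_sum.
  apply: eq_bigr => i _; congr (_ *: _).
  have := xU i; rewrite tE => /andP[h0 h1]; have /andP[t0 t1] := t01 i.
  have c1 : (c i)%:~R < 1%:~R :> R by lra.
  have c0 : (-1)%:~R < (c i)%:~R :> R by rewrite intrN; lra.
  rewrite !ltr_int in c0 c1; rewrite (_ : c i = 0) ?addr0//; lia.
have disc := discrepancy_region halpha vB S4 (AK _ Alast).
set rho := (slope v)^-1 in disc; set C := _ + _ in disc.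
have muE B : open_box v `<=` B -> B `<=` closed_box v ->
    measurable (lift_set (@torus_proj R s @` B)) ->
    torus_measure (@torus_proj R s @` B) = rho%:E.
  move=> UB BK mB; apply: torus_measure_of_discrepancy mB _ => x N.
  exact: disc.
have UK : open_box v `<=` closed_box v by exact: subset_trans AK.
(* The outer measure is monotone on arbitrary sets, so [A] is squeezed between two boxes with
   measurable lifts and the same measure [rho]. *)
have muA : torus_measure (@torus_proj R s @` A) = rho%:E.
  apply/eqP; rewrite eq_le; apply/andP; split.
    rewrite -(muE (closed_box v))//; first exact/le_torus_measure/image_subset.
    apply: (measurable_box_preimage v (b := fun r => 0 <= r <= 1)).
    rewrite (_ : [set r | _] = `[0, 1]%classic); first exact: measurable_itv.
    by apply/seteqP; split => r /=; rewrite in_itv.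
  rewrite -(muE (open_box v))//; first exact/le_torus_measure/image_subset.
  apply: (measurable_box_preimage v (b := fun r => 0 < r < 1)).
  rewrite (_ : [set r | _] = `]0, 1[%classic); first exact: measurable_itv.
  by apply/seteqP; split => r /=; rewrite in_itv.
apply: (@le_lt_trans _ _ C%:E); last exact: ltry.
apply: ge_ereal_sup => _ [x _ <-]; apply: ge_ereal_sup => _ [N _ <-].
rewrite lee_fin muA /=.
under eq_bigr do rewrite iter_rotation.
exact: disc.
Qed.
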